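(* Let $(X,d)$ be a metric space such that every closed proper ball in $X$ is totally bounded. If $(X,d)$ is non-separable, then $(CL(X),\tau_{w(d)})$ contains a closed copy of $\omega_1 \times (\omega_1 + 1)$, i.e. a closed subspace homeomorphic to $\omega_1 \times (\omega_1+1)$.
   Context: $CL(X)$ denotes the family of all nonempty closed subsets of $X$. For $x \in X$ and nonempty $A \subseteq X$, $d(x,A) = \inf\{d(x,a): a \in A\}$. The Wijsman topology $\tau_{w(d)}$ on $CL(X)$ is the weakest topology for which, for every $x \in X$, the distance functional $A \mapsto d(x,A)$ from $CL(X)$ to $[0,\infty)$ is continuous. A closed proper ball in $X$ is a closed ball in $X$ that is a proper subset of $X$. The ordinals $\omega_1$ (the first uncountable ordinal) and $\omega_1+1$ carry their order topologies, and $\omega_1\times(\omega_1+1)$ carries the product topology. *)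

(* Defs.v *)
From HB Require Import structures.
From mathcomp Require Import all_boot all_order all_algebra.
From mathcomp Require Import all_classical all_reals wochoice topology.

Set Implicit Arguments.
Unset Strict Implicit.
Unset Printing Implicit Defensive.

Import Order.TTheory GRing.Theory Num.Theory.
Import numFieldTopology.Exports.

Local Open Scope classical_set_scope.
Local Open Scope ring_scope.

Section MetricNotions.
Context {R : realType} {X : metricType R}.

(* Not the library's [closed_ball], which is the closure of the open ball and
   can be strictly smaller in a general metric space. *)
Definition metric_closed_ball (x : X) (r : R) : set X := [set y | mdist x y <= r].

Definition totally_bounded (A : set X) : Prop :=
  forall e : R, 0 < e ->
    exists2 F : set X, finite_set F & A `<=` \bigcup_(x in F) ball x e.

Definition dist_to_set (x : X) (A : set X) : R := inf [set mdist x a | a in A].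

End MetricNotions.

Definition separable (T : topologicalType) : Prop :=
  exists2 D : set T, countable D & dense D.

Definition homeomorphic (T U : topologicalType) : Prop :=
  exists (f : T -> U) (g : U -> T),
    [/\ cancel f g, cancel g f, continuous f & continuous g].

Definition CL (T : topologicalType) : Type :=
  [set A : set T | closed A /\ A !=set0].

HB.instance Definition _ (T : topologicalType) := Choice.on (CL T).

(* The functionals are taken with values in R rather than in [0, +oo[; since
   they are nonnegative, this generates the same topology. *)
Definition wijsman (R : realType) (X : metricType R) : Type :=
  sup_topology (fun x : X =>
    Topological.on (initial_topology (fun A : CL X => dist_to_set x (\val A)))).

HB.instance Definition _ (R : realType) (X : metricType R) :=
  Topological.on (wijsman X).

(* The ordinal omega_1: in some well-ordering of an uncountable type, the
   points with countably many predecessors form an initial segment of order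
   type omega_1; see [omega1_has_min], [omega1_countable_lt] and
   [omega1_uncountable], which characterize it up to order isomorphism. *)
Definition wo_base : Type := nat -> bool.

HB.instance Definition _ := Choice.copy wo_base {classic (nat -> bool)}.

Definition wo_base_le : rel wo_base := sval (well_ordering_principle wo_base).

Fact wo_base_wo : well_order wo_base_le.
Proof. exact: (svalP (well_ordering_principle wo_base)). Qed.

Fact wo_base_chain : wo_chain wo_base_le predT.
Proof. by move=> A _; exact: wo_base_wo. Qed.

Fact wo_base_le_refl : reflexive wo_base_le.
Proof. by move=> x; exact: (wo_chain_reflexive wo_base_chain). Qed.

Fact wo_base_le_anti : antisymmetric wo_base_le.
Proof. by move=> x y; exact: (wo_chain_antisymmetric wo_base_chain). Qed.

Fact wo_base_le_total : total wo_base_le.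
Proof. by move=> x y; exact: (wo_chainW wo_base_chain). Qed.

Fact wo_base_le_trans : transitive wo_base_le.
Proof.
move=> y x z xy yz.
have [|m [[mA mlb] _]] := @wo_base_wo [pred u | u \in [:: x; y; z]].
  by exists x; rewrite !inE eqxx.
have [mx my mz] : [/\ wo_base_le m x, wo_base_le m y & wo_base_le m z].
  by split; apply: mlb; rewrite !inE eqxx ?orbT.
move: mA; rewrite !inE => /or3P[] /eqP mE; subst m => //.
- by have -> : x = y by apply: wo_base_le_anti; rewrite xy mx.
- have zy : y = z by apply: wo_base_le_anti; rewrite yz my.
  by rewrite -zy.
Qed.

Fact wo_base_display : Order.disp_t. Proof. exact: Order.Disp tt tt. Qed.

HB.instance Definition _ := Order.Le_isPOrder.Build wo_base_display wo_base
  wo_base_le_refl wo_base_le_anti wo_base_le_trans.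

HB.instance Definition _ :=
  Order.POrder_isTotal.Build wo_base_display wo_base wo_base_le_total.

Definition omega1 : Type :=
  {x : wo_base | `[< countable [set y : wo_base | (y < x)%O] >]}.

Fact omega1_display : Order.disp_t. Proof. exact: Order.Disp tt tt. Qed.

HB.instance Definition _ := SubChoice.on omega1.
HB.instance Definition _ :=
  [SubChoice_isSubOrder of omega1 by <: with omega1_display].

Lemma omega1_has_min (A : set omega1) :
  A !=set0 -> exists2 m, A m & forall x, A x -> (m <= x)%O.
Proof.
move=> -[a Aa].
have [|m [[]]] := @wo_base_wo [pred u | `[< exists2 x, A x & val x = u >]].
  by exists (val a); apply/asboolP; exists a.
move=> /asboolP[x Ax <-] xlb _; exists x => // y Ay.
by apply: xlb; apply/asboolP; exists y.
Qed.

Lemma omega1_countable_lt (x : omega1) : countable [set y : omega1 | (y < x)%O].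
Proof.
have /asboolP := valP x; apply: sub_countable.
have valS : val @` [set y : omega1 | (y < x)%O] `<=` [set y | (y < val x)%O].
  by move=> _ [y yx <-].
apply: card_le_trans (subset_card_le valS).
by have /card_eqPle[] := inj_card_eq (A := [set y : omega1 | (y < x)%O])
  (f := val) (fun y z _ _ => @val_inj _ _ _ y z).
Qed.

Lemma omega1_uncountable : ~ countable [set: omega1].
Proof.
have wo_base_uncountable : ~ countable [set: wo_base].
  move=> /countable_injP[f] finj0; have {finj0} finj : injective f.
    by move=> x y; apply: finj0; rewrite inE.
  pose d : wo_base := fun n => `[< forall x : wo_base, f x = n -> ~~ x n >].
  case dE: (d (f d)).
    by move: (dE) => /asboolP/(_ d erefl); rewrite dE.
  by move/asboolP: (dE); apply => x /finj ->; rewrite dE.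
move=> com1; apply: wo_base_uncountable.
pose A := [set x : wo_base | countable [set y | (y < x)%O]].
have cA : countable A.
  apply: sub_countable com1; apply: card_le_trans (card_image_le val _).
  apply: subset_card_le => x Ax; have xP : `[< countable [set y | (y < x)%O] >].
    exact/asboolP.
  by exists (Sub x xP : omega1).
suff -> : [set: wo_base] = A by [].
apply/seteqP; split=> // x _; apply: contrapT => nAx.
have [|m [[]]] := @wo_base_wo [pred u | `[< ~ A u >]].
  by exists x; apply/asboolP.
move=> /asboolP nAm mlb _; apply: nAm.
apply: sub_countable cA; apply: subset_card_le => y ym.
apply: contrapT => nAy; move: ym => /=; rewrite ltNge => /negP; apply.
by apply: mlb; apply/asboolP.
Qed.

(* The ordinal successor: a greatest element [None] is added on top of T. *)
Definition succ_ord (T : Type) : Type := option T.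

HB.instance Definition _ (T : choiceType) := Choice.on (succ_ord T).

Section SuccOrd.
Context {d : Order.disp_t} {T : orderType d}.

Definition succ_ord_le : rel (succ_ord T) := fun x y =>
  match x, y with
  | _, None => true
  | None, Some _ => false
  | Some a, Some b => (a <= b)%O
  end.

Fact succ_ord_le_refl : reflexive succ_ord_le.
Proof. by case=> /=. Qed.

Fact succ_ord_le_anti : antisymmetric succ_ord_le.
Proof. by move=> [x|] [y|] //= /le_anti->. Qed.

Fact succ_ord_le_trans : transitive succ_ord_le.
Proof. by move=> [y|] [x|] [z|] //=; exact: le_trans. Qed.

Fact succ_ord_le_total : total succ_ord_le.
Proof. by move=> [x|] [y|] //=; exact: le_total. Qed.

HB.instance Definition _ := Order.Le_isPOrder.Build d (succ_ord T)
  succ_ord_le_refl succ_ord_le_anti succ_ord_le_trans.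

HB.instance Definition _ :=
  Order.POrder_isTotal.Build d (succ_ord T) succ_ord_le_total.

End SuccOrd.

(* Main.v *)
(* As X is non-separable, there are e > 0 and an e-separated family p indexed by
   omega_1 * nat. A totally bounded ball contains only finitely many of its
   points, so for every z and every t smaller than some distance from z, all but
   finitely many p_i are at distance > t from z. Hence D |-> {p_i | i in D} is
   continuous from the nonempty sets of indices, with the pointwise topology, to
   the Wijsman topology, and it suffices to embed the product into the former.
   Reading every index (x, n) as a pair (x, c), where c = h x n takes as values all
   ordinals <= x and an extra least element (encoded by None), send (a, b) to the
   set of the (x, c) with a <= x and c < b. As a tends to omega_1 these sets
   shrink to the empty set, which is not in CL(X): near any given point of CL(X)
   the ordinals a stay bounded, by some M, and the image of the compact set
   [0, M] * (omega_1 + 1) is closed. *)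

Require Import Defs.
From mathcomp Require Import all_boot all_order all_algebra.
From mathcomp Require Import all_classical all_reals topology.
From mathcomp Require Import lra.

Import Order.TTheory GRing.Theory Num.Theory.
Import numFieldTopology.Exports.

Local Open Scope classical_set_scope.
Local Open Scope ring_scope.

(** * Distance functionals and separated sets *)

Section DistToSet.
Context {R : realType} {X : metricType R}.
Implicit Types (x y : X) (A : set X).

Lemma dist_to_set_le x A a : A a -> dist_to_set x A <= mdist x a.
Proof.
move=> Aa; apply: ge_inf; last by exists a.
by exists 0 => _ [b _ <-]; exact: mdist_ge0.
Qed.

Lemma le_dist_to_set x A t :
  A !=set0 -> (forall a, A a -> t <= mdist x a) -> t <= dist_to_set x A.
Proof.
move=> [a Aa] tA; apply: lb_le_inf; first by exists (mdist x a), a.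
by move=> _ [b Ab <-]; exact: tA.
Qed.

Lemma dist_to_set_lt x A t :
  A !=set0 -> dist_to_set x A < t -> exists2 a, A a & mdist x a < t.
Proof.
move=> [a Aa] /inf_lt[|_ [b Ab <-] bt]; first by exists (mdist x a), a.
by exists b.
Qed.

Lemma dist_to_set_ge0 x A : A !=set0 -> 0 <= dist_to_set x A.
Proof. by move=> A0; apply: le_dist_to_set => // a _; exact: mdist_ge0. Qed.

Lemma dist_to_set0 x A : A x -> dist_to_set x A = 0.
Proof.
move=> Ax; apply/le_anti; rewrite dist_to_set_ge0 ?andbT; last by exists x.
by rewrite -(mdistxx x) dist_to_set_le.
Qed.

Lemma dist_to_set_eq0 x A :
  closed A -> A !=set0 -> dist_to_set x A = 0 -> A x.
Proof.
move=> cA A0 d0; apply: cA => U /nbhs_ballP[e /= e0 xeU].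
have [|a Aa xa] := @dist_to_set_lt x A e A0; first by rewrite d0.
by exists a; split=> //; apply: xeU; rewrite ballEmdist.
Qed.

Lemma separated_closed A e : 0 < e ->
  (forall a b, A a -> A b -> mdist a b < e -> a = b) -> closed A.
Proof.
move=> e0 sepA x clx.
have [|a [Aa]] := clx (ball x (e / 2)).
  by apply: nbhsx_ballx; rewrite divr_gt0.
rewrite ballEmdist /= => xa; have [->//|xNa] := eqVneq x a.
have xa0 : 0 < mdist x a by rewrite mdist_gt0.
(* The radius [mdist x a] excludes [a] itself, yet the triangle inequality puts [b] within [e] of
   [a]. *)
have [b [Ab]] := clx _ (nbhsx_ballx x _ xa0).
rewrite ballEmdist /= => xb; suff ab : a = b by move: xb; rewrite ab ltxx.
apply: sepA => //; have := metric_triangle a x b.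
rewrite (metric_sym a x); lra.
Qed.

End DistToSet.

(** * Convergence and separation in the Wijsman topology *)

Section Wijsman.
Context {R : realType} {X : metricType R}.

Lemma wijsman_cvgP {F : set_system (wijsman X)} {FF : Filter F}
    (A : wijsman X) :
  F --> A <-> forall x,
    (fun B : CL X => dist_to_set x (\val B)) @ F --> dist_to_set x (\val A).
Proof.
split=> [FA x|FA].
  have {}FA := (cvg_sup _ _ FF).1 FA x; move=> U Ux.
  exact/FA/initial_continuous.
apply/(cvg_sup _ _ FF).2 => x U [_ [[V oV <-] /= Vx] VU].
by apply: filterS VU _; apply: FA; exact: open_nbhs_nbhs.
Qed.

Lemma wijsman_dist_continuous x :
  continuous (fun A : wijsman X => dist_to_set x (\val (A : CL X))).
Proof. by move=> A; exact: ((wijsman_cvgP (F := nbhs A) A).1 cvg_id). Qed.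

Lemma wijsman_near_lt x (A : wijsman X) (r : R) :
  dist_to_set x (\val (A : CL X)) < r ->
  \forall B \near A, dist_to_set x (\val (B : CL X)) < r.
Proof. by move=> /lt_nbhsl; exact: wijsman_dist_continuous. Qed.

Lemma wijsman_near_gt x (A : wijsman X) (r : R) :
  r < dist_to_set x (\val (A : CL X)) ->
  \forall B \near A, r < dist_to_set x (\val (B : CL X)).
Proof. by move=> /lt_nbhsr; exact: wijsman_dist_continuous. Qed.

(** A nonempty closed set is the zero set of its distance functional. *)
Lemma CL_dist_inj (A B : CL X) :
  (forall x, dist_to_set x (\val A) = dist_to_set x (\val B)) -> A = B.
Proof.
have [cA A0] := set_mem (valP A); have [cB B0] := set_mem (valP B) => AB.
apply: val_inj => /=; apply/seteqP; split=> x Cx; apply: dist_to_set_eq0 => //.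
  by rewrite -AB dist_to_set0.
by rewrite AB dist_to_set0.
Qed.

Lemma wijsman_hausdorff : hausdorff_space (wijsman X).
Proof.
move=> A B; rewrite cluster_cvgE => -[F PF [FB AF]].
apply: CL_dist_inj => x.
have FF : Filter F by exact: filter_filter.
have FAx := (wijsman_cvgP (FF := FF) A).1 AF x.
have FBx := (wijsman_cvgP (FF := FF) B).1 FB x.
exact: (cvg_unique (@Rhausdorff R) FAx FBx).
Qed.

End Wijsman.

(** * The order topology of a well-order *)

Section WellOrderTopology.
Context {d : Order.disp_t} {T : orderTopologicalType d}.

Lemma order_cvg (F : set_system T) (a : T) : Filter F ->
  F [set x | (x <= a)%O] -> (forall b, (b < a)%O -> F [set x | (b < x)%O]) ->
  F --> a.
Proof.
move=> FF Fa Fb U; rewrite itv_nbhsE => -[[l r] [oi /andP[la ar]] iU].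
apply: filterS iU _.
have Fl : F [set x | (l <= BLeft x)%O].
  case: l oi la => [[] b|[]] oi la //; last by apply: filterS filterT => x _.
  by apply: filterS (Fb b _) => // x.
apply: filterS2 Fl Fa => x lx xa; apply/andP; split => //.
exact: le_trans ar.
Qed.

Context (T_min : forall A : set T,
  A !=set0 -> exists2 m, A m & forall x, A x -> (m <= x)%O).

(** The segment [[0, x]] is clopen: its complement is an open ray, and it is itself either
    everything or the open ray below the successor of [x]. *)
Lemma wo_near_le (a x : T) : \forall b \near a, (b <= x)%O = (a <= x)%O.
Proof.
have [ax|xa] := leP a x; last first.
  have : open_nbhs a (`]x, +oo[ : set T).
    by split; [exact: rray_open|rewrite /= in_itv/= xa].
  move=> /open_nbhs_nbhs; apply: filterS => b /=.
  by rewrite in_itv/= andbT => xb; apply/negbTE; rewrite -ltNge.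
have [[m xm]|nm] := pselect ([set m | (x < m)%O] !=set0); last first.
  by apply: nearW => b; apply: contra_notT nm; rewrite -ltNge => ?; exists b.
have [|{xm}m /= xm mmin] := T_min [set m | (x < m)%O]; first by exists m.
have : open_nbhs a (`]-oo, m[ : set T).
  by split; [exact: lray_open|rewrite /= in_itv/= (le_lt_trans ax)].
move=> /open_nbhs_nbhs; apply: filterS => b /=; rewrite in_itv/= => bm.
by apply: contraTT bm; rewrite -leNgt -ltNge => /mmin.
Qed.

(** An ultrafilter containing [[0, M]] converges to the least [m] such that it contains [[0, m]]. *)
Lemma wo_compact_le (M : T) : compact [set x : T | (x <= M)%O].
Proof.
rewrite compact_ultra => F UF FM.
have [|m Fm mmin] := T_min [set m | F [set x | (x <= m)%O]]; first by exists M.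
exists m; split; first exact: mmin.
apply: order_cvg => // b bm.
have [Fb|] := in_ultra_setVsetC [set x | (x <= b)%O] UF.
  by have := mmin _ Fb; rewrite leNgt bm.
by apply: filterS => x /=; rewrite ltNge => /negP.
Qed.

End WellOrderTopology.

Lemma succ_ord_has_min {d : Order.disp_t} {T : orderType d} :
  (forall A : set T, A !=set0 -> exists2 m, A m & forall x, A x -> (m <= x)%O) ->
  forall A : set (succ_ord T),
    A !=set0 -> exists2 m, A m & forall x, A x -> (m <= x)%O.
Proof.
move=> T_min A [a Aa].
have [A0|nA0] := pselect ([set x | A (Some x)] !=set0); last first.
  have AN x : A x -> x = None.
    by case: x => // x Ax; exfalso; apply: nA0; exists x.
  by exists a => // x /AN ->; rewrite (AN _ Aa).
have [m Am mmin] := T_min _ A0.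
by exists (Some m) => // -[x /mmin|//].
Qed.

Lemma wf_of_min {T : Type} (r : T -> T -> Prop) :
  (forall A : set T, A !=set0 -> exists2 m, A m & forall x, r x m -> ~ A x) ->
  well_founded r.
Proof.
move=> r_min x; apply: contrapT => nx.
have [|m nm mmin] := r_min [set y | ~ Acc r y]; first by exists x.
by apply: nm; constructor => y /mmin/contrapT.
Qed.

(** * Separated families in a non-separable space *)

Section Recursion.
Context {R : realType} {X : metricType R}.

(** If every scale [1 / (n + 1)] failed, each would have a countable net, and the union of these
    nets would be countable and dense. *)
Lemma nonseparable_gap : ~ separable X ->
  exists2 e : R, 0 < e &
    forall D : set X, countable D -> exists x, forall y, D y -> e <= mdist x y.
Proof.
move=> nsep; apply: contrapT => ngap; apply: nsep.
have /choice[D Dcov] : forall n : nat, exists D : set X,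
    countable D /\ forall x, exists2 y, D y & mdist x y < n.+1%:R^-1.
  move=> n; apply: contrapT => nD; apply: ngap; exists n.+1%:R^-1 => [|D cD].
    by rewrite invr_gt0 ltr0Sn.
  apply: contrapT => nx; apply: nD; exists D; split=> // x.
  apply: contrapT => ny; apply: nx; exists x => y Dy.
  by rewrite leNgt; apply/negP => xy; apply: ny; exists y.
exists (\bigcup_n D n).
  by apply: bigcup_countable => // n _; exact: (Dcov n).1.
move=> U [x Ux] oU.
have /nbhs_ballP[e /= e0 xeU] : nbhs x U by exact: open_nbhs_nbhs.
have [n ne] : exists n : nat, n.+1%:R^-1 < e.
  exists (Num.truncn e^-1); rewrite invf_plt ?posrE ?ltr0Sn//.
  exact: truncnS_gt.
have [y Dy xy] := (Dcov n).2 x.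
exists y; split; last by exists n.
by apply: xeU; rewrite ballEmdist; exact: lt_trans ne.
Qed.

(** By recursion along [r]: the values already chosen below [i] form a countable set, and the gap
    hypothesis yields a point far from all of them. *)
Lemma separated_family {T : Type} (r : T -> T -> Prop) (e : R) :
  well_founded r -> (forall i, countable [set j | r j i]) ->
  (forall D : set X, countable D -> exists x, forall y, D y -> e <= mdist x y) ->
  exists p : T -> X, forall i j, r j i -> e <= mdist (p i) (p j).
Proof.
move=> r_wf r_cnt gap.
(* [next] is total, with an arbitrary value on uncountable sets; countability is checked only after
   the recursion. *)
have /choice[next nextP] : forall D : set X, exists x,
    countable D -> forall y, D y -> e <= mdist x y.
  move=> D; have [/gap[x xD]|nD] := pselect (countable D); first by exists x.
  by have [x _] := gap set0 (countable0 _); exists x.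
pose step i (rec : forall j, r j i -> X) :=
  next [set y | exists j (ji : r j i), y = rec j ji].
exists (Fix r_wf (fun=> X) step) => i j ji.
rewrite [X in mdist X _]Fix_eq; last first.
  move=> k f g fg; congr step.
  by do 2!apply: functional_extensionality_dep => ?.
apply: nextP; last by exists j, ji.
apply: sub_countable (r_cnt i).
apply: card_le_trans (card_image_le (Fix r_wf (fun=> X) step) _).
by apply: subset_card_le => _ [k [ki ->]]; exists k.
Qed.

End Recursion.

(** * The index set [omega1 * nat] and its codes *)

Definition lexi_lt (i j : omega1 * nat) : Prop :=
  (i.1 < j.1)%O \/ i.1 = j.1 /\ (i.2 < j.2)%N.

Lemma lexi_lt_wf : well_founded lexi_lt.
Proof.
apply: wf_of_min => A [[a n] Aan].
have [|x [k Axk] xmin] := @omega1_has_min [set x | exists n, A (x, n)].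
  by exists a, n.
have exn : exists k, `[< A (x, k) >] by exists k; apply/asboolP.
case: (ex_minnP exn) => m /asboolP Axm mmin.
exists (x, m) => // -[y l] [/= yx|/= [-> lm]] Ayl.
  by have := xmin y; rewrite leNgt yx => /(_ (ex_intro _ _ Ayl)).
by have := mmin l; rewrite leqNgt lm => /(_ (asboolT Ayl)).
Qed.

Lemma omega1_countable_le (x : omega1) : countable [set y | (y <= x)%O].
Proof.
have -> : [set y | (y <= x)%O] =
    \bigcup_(b in [set: bool]) [set y | if b then y = x else (y < x)%O].
  apply/seteqP; split=> [y /=|y [[] _ /=]].
  - by rewrite le_eqVlt => /predU1P[yx|yx]; [exists true|exists false].
  - by move=> ->.
  - exact: ltW.
apply: bigcup_countable => // -[] _; last exact: omega1_countable_lt.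
exact: (countable1 x).
Qed.

Lemma lexi_lt_countable (i : omega1 * nat) : countable [set j | lexi_lt j i].
Proof.
apply: sub_countable
  (countableX (omega1_countable_le i.1) (countableP [set: nat])).
apply: subset_card_le => j [/= /ltW ji|/= [-> _]]; split => //=.
Qed.

Lemma lexi_lt_total (i j : omega1 * nat) : i <> j -> lexi_lt i j \/ lexi_lt j i.
Proof.
case: i j => [x n] [y m] ij; rewrite /lexi_lt /=.
case: (ltgtP x y) => [||xy]; [by left; left|by right; left|].
case: (ltngtP n m) => [||nm]; [by left; right|by right; right|].
by exfalso; apply: ij; rewrite xy nm.
Qed.

Lemma omega1_enum : exists h : omega1 -> nat -> succ_ord omega1,
  forall x, h x 0%N = None /\ forall y, (y <= x)%O -> exists n, h x n = Some y.
Proof.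
suff /choice[h hP] : forall x : omega1, exists c : nat -> succ_ord omega1,
  c 0%N = None /\ forall y, (y <= x)%O -> exists n, c n = Some y by exists h.
move=> x.
have /countable_injP[f finj] := omega1_countable_le x.
(* The shift by one reserves index 0 for [None], which is also the default at indices that no
   ordinal reaches. *)
have g n : exists c : succ_ord omega1,
    forall y, (y <= x)%O -> (f y).+1 = n -> c = Some y.
  have [[y [yx fy]]|ny] := pselect (exists y, (y <= x)%O /\ (f y).+1 = n).
    exists (Some y) => z zx fz; congr Some; apply: finj; rewrite ?inE //.
    by move: fy; rewrite -fz => -[].
  by exists None => y yx fy; exfalso; apply: ny; exists y.
have /choice[{}g gP] := g.
exists (fun n => if n is 0 then None else g n); split => // y yx.
by exists (f y).+1; exact: gP.
Qed.

(** * Closed embeddings and finite intersections in filters *)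

Lemma closed_embedding_homeomorphic {T U : topologicalType} (phi : T -> U) :
  injective phi -> continuous phi -> closed (range phi) ->
  (forall t, filter_from (nbhs (phi t)) (preimage phi) --> t) ->
  exists2 A : set U, closed A & homeomorphic (A : Type) T.
Proof.
move=> phi_inj phi_cont phi_closed phi_inv; exists (range phi) => //.
have /choice[f fP] : forall u : range phi, exists t, phi t = \val u.
  by move=> u; have [t _ <-] := set_valP u; exists t.
pose g t : range phi := exist _ (phi t) (mem_set (ex_intro2 _ _ t I erefl)).
have fK : cancel f g by move=> u; apply: val_inj; rewrite /= fP.
have gK : cancel g f by move=> t; apply: phi_inj; rewrite fP.
(* Continuity of [f] is the convergence hypothesis: a neighbourhood of [f u] contains the preimage
   of one of [phi (f u)]. *)
exists f, g; split=> // [u W /phi_inv[V Vu VW]|].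
  rewrite fP in Vu.
  have uV : nbhs u (set_val @^-1` V) by exact: initial_continuous.
  by apply: filterS uV => v Vv; apply: VW; rewrite /= fP.
exact: (continuous_comp_initial (w := set_val)).
Qed.

Lemma filter_finite_forall {T I} {D : set I} {F : set_system T}
    {P : I -> T -> Prop} : Filter F -> finite_set D ->
  (forall i, D i -> F (P i)) -> F [set x | forall i, D i -> P i x].
Proof.
elim/Pchoice: I => I in D P *; move=> FF finD DP.
rewrite -(fset_setK finD); apply: filter_bigI => i.
by rewrite in_fset_set// inE; exact: DP.
Qed.

(** * Separated families and total boundedness *)

Section Separated.
Context {R : realType} {X : metricType R} {I : Type} (p : I -> X) (e : R).
Context (e_gt0 : 0 < e) (p_sep : forall i j, i <> j -> e <= mdist (p i) (p j)).

Lemma separated_eq i j : mdist (p i) (p j) < e -> i = j.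
Proof.
by move=> ij; apply: contrapT => /p_sep; rewrite leNgt ij.
Qed.

Lemma separated_near_eq x i j :
  mdist x (p i) < e / 2 -> mdist x (p j) < e / 2 -> i = j.
Proof.
move=> xi xj; apply: separated_eq.
have := metric_triangle (p i) x (p j); rewrite (metric_sym (p i) x); lra.
Qed.

(** A ball of radius [e / 2] contains at most one [p i], so sending an index to the centre of a ball
    covering its point is injective into a finite set. *)
Lemma totally_bounded_separated A : totally_bounded A -> finite_set (p @^-1` A).
Proof.
move=> /(_ (e / 2)) [|F finF AF]; first by rewrite divr_gt0.
have /choice[c cP] : forall i, exists x,
    A (p i) -> F x /\ mdist x (p i) < e / 2.
  move=> i; have [/AF[x Fx]|nA] := pselect (A (p i)); last by exists (p i).
  by rewrite ballEmdist => xi; exists x.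
rewrite -(eq_finite_set (inj_card_eq (f := c) _)).
  by apply: sub_finite_set finF => _ [i /cP[Fi _] <-].
move=> i j /set_mem/cP[_ ci] /set_mem/cP[_ cj] cij.
by apply: separated_near_eq ci _; rewrite cij.
Qed.

Lemma separated_image_closed (D : set I) : closed (p @` D).
Proof.
apply: (separated_closed _ _ e_gt0) => _ _ [i _ <-] [j _ <-] ij.
by rewrite (separated_eq _ _ ij).
Qed.

End Separated.

(** * The embedding of the product into the hyperspace *)

Section Embedding.
Context {R : realType} {X : metricType R} (p : omega1 * nat -> X) (e : R).
Context (e_gt0 : 0 < e) (p_sep : forall i j, i <> j -> e <= mdist (p i) (p j)).
Context (h : omega1 -> nat -> succ_ord omega1).
Context (h0 : forall x, h x 0%N = None).
Context (hS : forall x y : omega1, (y <= x)%O -> exists n, h x n = Some y).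
Context (tb : forall (x : X) (r : R), 0 < r ->
  metric_closed_ball x r `<` [set: X] ->
  totally_bounded (metric_closed_ball x r)).

Local Notation T1 := (order_topology omega1).
Local Notation T2 := (order_topology (succ_ord omega1)).
Local Notation T := (T1 * T2)%type.

(** In [succ_ord omega1] the element [None] is greatest, so as a code below all ordinals it needs
    its own disjunct; this keeps the set nonempty even when [t.2] is least. *)
Definition codes (t : T) : set (omega1 * nat) :=
  [set i | (t.1 <= (i.1 : T1))%O /\
    (h i.1 i.2 = None \/ ((h i.1 i.2 : T2) < t.2)%O)].

Lemma codes_first (t : T) : codes t (t.1 : omega1, 0%N).
Proof. by split=> //; left; exact: h0. Qed.

Lemma image_codes_first t : (p @` codes t) (p (t.1 : omega1, 0%N)).
Proof. by apply: imageP; exact: codes_first. Qed.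

Lemma image_codes_nonempty t : p @` codes t !=set0.
Proof. by exists (p (t.1 : omega1, 0%N)); exact: image_codes_first. Qed.

(** Each of the two comparisons with [i] is a clopen condition on a coordinate of [t]. *)
Lemma codes_near (t : T) i : \forall s \near t, codes s i <-> codes t i.
Proof.
have n1 := wo_near_le (T := T1) omega1_has_min t.1 (i.1 : T1).
have n2 := wo_near_le (T := T2) (succ_ord_has_min omega1_has_min) t.2
  (h i.1 i.2 : T2).
exists ([set a : T1 | (a <= (i.1 : T1))%O = (t.1 <= (i.1 : T1))%O],
  [set b : T2
  | (b <= (h i.1 i.2 : T2))%O = (t.2 <= (h i.1 i.2 : T2))%O]) => //.
by move=> [a b] [/= ha hb]; rewrite /codes /= ha !ltNge hb.
Qed.

(* Convergence in the product is detected by membership of the codes: [(b, 0)]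
   tests [b < s.1] and, once [s.1 <= t.1], a code of [y] at level
   [max t.1 y] tests [y < s.2]. *)
Lemma codes_cvg (F : set_system T) (t : T) : Filter F ->
  (forall i, F [set s | codes s i <-> codes t i]) -> F --> t.
Proof.
move=> FF Fi; case: t => a b in Fi *.
have Fa : F [set s | (s.1 <= a)%O].
  apply: filterS (Fi (a : omega1, 0%N)) => s /= [_ /(_ (codes_first _))].
  by case.
have Fy (y : omega1) :
    F [set s | ((Some y : T2) < s.2)%O <-> ((Some y : T2) < b)%O].
  pose x := Order.max (a : omega1) y.
  have [n hn] : exists n, h x n = Some y by apply: hS; rewrite le_max lexx orbT.
  have ax : (a <= x)%O by rewrite le_max lexx.
  apply: filterS2 Fa (Fi (x, n)) => s /= sa; rewrite /codes /= hn.
  move=> [st ts]; split=> y_lt.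
    by have [|_ []] := st; first by split; [exact: le_trans ax|right].
  by have [|_ []] := ts; first by split; [|right].
have Fst : fst @ F --> a.
  apply: (order_cvg (T := T1) (fst @ F) a) => // c ca.
  suff : F [set s | (c < s.1)%O] by [].
  apply: filterS (Fi (c, 0%N)) => s /= [sc _]; rewrite ltNge; apply/negP => sc'.
  have [|] := sc; first by split=> //; left; exact: h0.
  by rewrite /= leNgt ca.
have Fsnd : snd @ F --> b.
  apply: (order_cvg (T := T2) (snd @ F) b) => [|[y|] yb]; last first.
  - by have : (b <= (None : T2))%O; [case: (b)|rewrite leNgt yb].
  - suff : F [set s | ((Some y : T2) < s.2)%O] by [].
    by apply: filterS (Fy y) => s /= [_ ->].
  - suff : F [set s | (s.2 <= b)%O] by [].
    case: b Fy {Fi} => [y Fy|Fy]; last by apply: filterS filterT => -[x []].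
    apply: filterS (Fy y) => s /= [sy _]; rewrite leNgt; apply/negP => /sy.
    by rewrite ltxx.
move=> U /(cvg_pair Fst Fsnd) FU.
have {}FU : F [set s | U (s.1, s.2)] by [].
by apply: filterS FU => -[].
Qed.

(** If the codes agree, the principal filter at [s] converges to both [s] and [t], and order
    topologies are Hausdorff. *)
Lemma codes_inj : injective codes.
Proof.
move=> s t st; pose F := globally [set s].
have FP : ProperFilter F by exact: (@globally_properfilter _ _ s).
have Fs : F --> s by move=> U /nbhs_singleton Us _ ->.
have Ft : F --> t by apply: codes_cvg => i _ -> /=; rewrite st.
have Fs1 : fst @ F --> s.1 by exact: cvg_comp Fs cvg_fst.
have Ft1 : fst @ F --> t.1 by exact: cvg_comp Ft cvg_fst.
have Fs2 : snd @ F --> s.2 by exact: cvg_comp Fs cvg_snd.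
have Ft2 : snd @ F --> t.2 by exact: cvg_comp Ft cvg_snd.
rewrite (surjective_pairing s) (surjective_pairing t).
by congr pair; [exact: (cvg_unique (@order_hausdorff _ T1) Fs1 Ft1)|
  exact: (cvg_unique (@order_hausdorff _ T2) Fs2 Ft2)].
Qed.

Definition embedding (t : T) : wijsman X := exist _ (p @` codes t)
  (mem_set (conj (separated_image_closed p e e_gt0 p_sep (codes t))
                 (image_codes_nonempty t))).

Lemma embedding_codes t i : codes t i <-> sval (embedding t) (p i).
Proof.
split=> [ti|/= [j tj /esym pij]]; first exact: imageP.
suff -> : i = j by [].
by apply: (separated_eq p e p_sep); rewrite pij mdistxx.
Qed.

Lemma embedding_inj : injective embedding.
Proof.
move=> s t st; apply: codes_inj; apply/seteqP.
by split=> i /embedding_codes; [rewrite st|rewrite -st] => /embedding_codes.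
Qed.

Lemma embedding_continuous : continuous embedding.
Proof.
move=> t; apply/wijsman_cvgP => x; apply/(@cvg_ballP R) => eps eps0.
set v := dist_to_set x _.
(* A single index that nearly realises the distance at [t] remains a code of all nearby [s]. *)
have up : \forall s \near t, dist_to_set x (p @` codes s) < v + eps.
  have [||_ [i ti <-] xi] := @dist_to_set_lt _ _ x (p @` codes t) (v + eps).
  - exact: image_codes_nonempty.
  - by rewrite ltrDl.
  apply: filterS (codes_near t i) => s [_ /(_ ti) si].
  by apply: le_lt_trans xi; apply: dist_to_set_le; exact: imageP.
have low : \forall s \near t, v - eps < dist_to_set x (p @` codes s).
  have [v0|v0] := leP v (eps / 2).
    apply: (@nearW _ (nbhs t)) => s; apply: (@lt_le_trans _ _ 0).
      by lra.
    exact/dist_to_set_ge0/image_codes_nonempty.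
  (* This ball is proper, as it misses a point of the image of [t]. None of its finitely many
     indices is a code of [t], hence none is a code of a nearby [s]. *)
  have fin : finite_set (p @^-1` metric_closed_ball x (v - eps / 2)).
    apply: (totally_bounded_separated _ _ e_gt0 p_sep); apply: tb; first by lra.
    split=> // /(_ (p (t.1 : omega1, 0%N)) I); rewrite /metric_closed_ball /=.
    have : v <= mdist x (p (t.1 : omega1, 0%N)).
      by apply: dist_to_set_le; exact: image_codes_first.
    by lra.
  have tall := filter_finite_forall (nbhs_filter t) fin
    (fun i _ => codes_near t i).
  apply: filterS tall => s ts; apply: (@lt_le_trans _ _ (v - eps / 2)).
    by lra.
  apply: le_dist_to_set => [|_ [i si <-]]; first exact: image_codes_nonempty.
  rewrite leNgt; apply/negP => xi.
  have /(ts i (ltW xi))ti := si.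
  have : v <= mdist x (p i) by apply: dist_to_set_le; exact: imageP.
  by lra.
apply: filterS2 up low => s /= sup slow.
by rewrite /ball /= ltr_distlC; apply/andP.
Qed.

(** The distance from [p i] to an image is 0 if [i] is a code and at least [e] otherwise, so
    Wijsman-open conditions decide membership of [i]. *)
Lemma embedding_inv t :
  filter_from (nbhs (embedding t)) (preimage embedding) --> t.
Proof.
have FF : Filter (filter_from (nbhs (embedding t)) (preimage embedding)).
  apply: filter_from_filter; first by exists setT; exact: filterT.
  by move=> U V Ut Vt; exists (U `&` V) => //; exact: filterI.
apply: codes_cvg => i.
have [ti|nti] := pselect (codes t i).
  exists [set C : wijsman X | dist_to_set (p i) (sval C) < e].
    apply: wijsman_near_lt.
    by rewrite dist_to_set0//; exact/embedding_codes.
  move=> s /= /dist_to_set_lt[|_ [j sj <-] /(separated_eq _ _ p_sep)ij].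
    exact: image_codes_nonempty.
  by split=> // _; rewrite ij.
exists [set C : wijsman X | 0 < dist_to_set (p i) (sval C)].
  apply: wijsman_near_gt.
  apply: (lt_le_trans e_gt0); apply: le_dist_to_set.
    exact: image_codes_nonempty.
  by move=> _ [j tj <-]; apply: p_sep => ij; apply: nti; rewrite ij.
move=> s /= s0; split=> // /embedding_codes si.
by move: s0; rewrite dist_to_set0// ltxx.
Qed.

Lemma embedding_closed : closed (range embedding).
Proof.
move=> B clB; have [_ [z Bz]] := set_mem (valP B).
pose N := [set C : wijsman X | dist_to_set z (sval C) < e / 2].
have NB : nbhs B N.
  apply: wijsman_near_lt.
  by rewrite dist_to_set0// divr_gt0.
have Ncodes t : N (embedding t) -> exists2 i, codes t i & mdist z (p i) < e / 2.
  move=> /dist_to_set_lt[|_ [i ti <-] zi]; last by exists i.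
  exact: image_codes_nonempty.
have [_ [[t _ <-] /Ncodes[i ti zi]]] := clB _ NB.
(* At most one [p i] lies within [e / 2] of [z], so every [s] whose image is in [N] has this same
   code [i], whence [s.1 <= i.1]. *)
pose K := [set a : T1 | (a <= i.1)%O] `*`
  [set: T2].
have cK : compact (embedding @` K).
  apply: continuous_compact.
    by apply: continuous_subspaceT => ?; exact: embedding_continuous.
  apply: compact_setX; first exact: (wo_compact_le (T := T1) omega1_has_min).
  have := wo_compact_le (T := T2) (succ_ord_has_min omega1_has_min)
    (None : T2).
  by congr compact; apply/seteqP; split=> // -[].
suff : (embedding @` K) B by move=> [s _ <-]; exists s.
(* Compact sets are closed here, so it suffices that [B] is a closure point of the image of [K]. *)
apply: (compact_closed wijsman_hausdorff cK) => U UB.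
have [_ [[s _ <-] [Us /Ncodes[j sj zj]]]] := clB _ (filterI UB NB).
exists (embedding s); split=> //; exists s => //; split=> //=.
rewrite (separated_near_eq p e p_sep z i j zi zj); exact: sj.1.
Qed.

End Embedding.

Theorem theorem3p2 (R : realType) (X : metricType R)
  (tb : forall (x : X) (r : R), 0 < r ->
     metric_closed_ball x r `<` [set: X] ->
     totally_bounded (metric_closed_ball x r))
  (nonsep : ~ separable X) :
  exists2 A : set (wijsman X), closed A &
    homeomorphic (A : Type)
      (order_topology omega1 * order_topology (succ_ord omega1))%type.
Proof.
have [e e0 gap] := nonseparable_gap nonsep.
have [p pP] := separated_family lexi_lt e lexi_lt_wf lexi_lt_countable gap.
have p_sep i j : i <> j -> e <= mdist (p i) (p j).
  by move=> /lexi_lt_total[]/pP//; rewrite metric_sym.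
have [h hP] := omega1_enum.
have h0 x : h x 0%N = None := (hP x).1.
have hS x y : (y <= x)%O -> exists n, h x n = Some y := (hP x).2 y.
apply: (closed_embedding_homeomorphic (embedding p e e0 p_sep h h0)).
- exact: embedding_inj.
- exact: embedding_continuous.
- exact: embedding_closed.
- exact: embedding_inv.
Qed.
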